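(* Let $H$ be a nonempty finite disjoint union of linear graphs (paths) and cycle graphs, all of whose lengths are not divisible by $3$. Then the graph complement $\overline{H}$ is homotopic to a $d$-sphere for some $d\ge 0$, where $d$ is determined by the lengths (and types) of the components of $H$.
   Context: All graphs are finite and simple. The length of a linear graph or of a cycle graph is its number of edges (so the linear graph with $n$ vertices has length $n-1$, and $C_n$ has length $n$). The unit sphere $S(x)$ of a vertex $x$ is the subgraph induced by the neighbors of $x$. A graph is contractible if it is the one-point graph $K_1$ or (inductively) if it has a vertex $x$ such that both $S(x)$ and the graph $G-x$ with $x$ removed are contractible. A homotopy extension of $G$ adds a new vertex joined exactly to the vertices of a contractible induced subgraph $A$ of $G$; a homotopy reduction is the reverse (removing a vertex $x$ with $S(x)$ contractible). Two graphs are homotopic if one is obtained from the other by finitely many homotopy extensions and reductions. Spheres are defined inductively: the empty graph is the $(-1)$-sphere, and for $d\ge 0$ a $d$-sphere is a graph all of whose unit spheres are $(d-1)$-spheres and which becomes contractible after removing some vertex. *)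

(* Defs.v *)
From HB Require Import structures.
From mathcomp Require Import all_boot.
Set Implicit Arguments.
Unset Strict Implicit.
Unset Printing Implicit Defensive.

Record sgraph := SGraph {
  vertex :> finType;
  adj : rel vertex;
  adj_sym : symmetric adj;
  adj_irrefl : irreflexive adj
}.

Definition isomorphic (G H : sgraph) : Prop :=
  exists f : G -> H, bijective f /\ forall x y, adj (f x) (f y) = adj x y.

Section Induced.
Variables (G : sgraph) (A : {set G}).
Definition induced_adj : rel {x : G | x \in A} :=
  fun x y => adj (val x) (val y).
Lemma induced_sym : symmetric induced_adj.
Proof. by move=> x y; rewrite /induced_adj adj_sym. Qed.
Lemma induced_irrefl : irreflexive induced_adj.
Proof. by move=> x; rewrite /induced_adj adj_irrefl. Qed.
Definition induced : sgraph := SGraph induced_sym induced_irrefl.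
End Induced.

Definition unit_sphere (G : sgraph) (x : G) : sgraph :=
  induced [set y | adj x y].

Definition remove_vertex (G : sgraph) (x : G) : sgraph := induced [set~ x].

Inductive contractible : sgraph -> Prop :=
| contractible_point (G : sgraph) : #|G| = 1 -> contractible G
| contractible_step (G : sgraph) (x : G) :
    contractible (unit_sphere x) -> contractible (remove_vertex x) ->
    contractible G.

(* [None] is the new vertex. *)
Section Extension.
Variables (G : sgraph) (A : {set G}).
Definition extension_adj : rel (option G) := fun u v =>
  match u, v with
  | Some x, Some y => adj x y
  | Some x, None | None, Some x => x \in A
  | None, None => false
  end.
Lemma extension_sym : symmetric extension_adj.
Proof. by case=> [x|] [y|] //=; rewrite adj_sym. Qed.
Lemma extension_irrefl : irreflexive extension_adj.
Proof. by case=> [x|] //=; rewrite adj_irrefl. Qed.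
Definition extension : sgraph := SGraph extension_sym extension_irrefl.
End Extension.

(* A homotopy reduction is an extension step read backwards, up to renaming
   of the vertices. *)
Inductive homotopic : sgraph -> sgraph -> Prop :=
| homotopic_iso (G H : sgraph) : isomorphic G H -> homotopic G H
| homotopic_extension (G : sgraph) (A : {set G}) :
    contractible (induced A) -> homotopic G (extension A)
| homotopic_sym (G H : sgraph) : homotopic G H -> homotopic H G
| homotopic_trans (G H K : sgraph) :
    homotopic G H -> homotopic H K -> homotopic G K.

(* The index is shifted: [presphere n] describes the (n - 1)-spheres, so that
   the recursion can start at the (-1)-sphere, the empty graph. *)
Fixpoint presphere (n : nat) (G : sgraph) : Prop :=
  match n with
  | 0 => #|G| = 0
  | m.+1 => (forall x : G, presphere m (unit_sphere x)) /\
            exists x : G, contractible (remove_vertex x)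
  end.

Definition is_sphere (d : nat) (G : sgraph) : Prop := presphere d.+1 G.

Section Complement.
Variable G : sgraph.
Definition complement_adj : rel G := fun x y => (x != y) && ~~ adj x y.
Lemma complement_sym : symmetric complement_adj.
Proof. by move=> x y; rewrite /complement_adj eq_sym adj_sym. Qed.
Lemma complement_irrefl : irreflexive complement_adj.
Proof. by move=> x; rewrite /complement_adj eqxx. Qed.
Definition complement : sgraph := SGraph complement_sym complement_irrefl.
End Complement.

Section EmptyGraph.
Definition empty_adj : rel void := fun _ _ => false.
Lemma empty_sym : symmetric empty_adj. Proof. by []. Qed.
Lemma empty_irrefl : irreflexive empty_adj. Proof. by []. Qed.
Definition empty_graph : sgraph := SGraph empty_sym empty_irrefl.
End EmptyGraph.

Section Sum.
Variables G H : sgraph.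
Definition sum_adj : rel (G + H) := fun u v =>
  match u, v with
  | inl x, inl y => adj x y
  | inr x, inr y => adj x y
  | _, _ => false
  end.
Lemma sum_sym : symmetric sum_adj.
Proof. by case=> x [] y //=; rewrite adj_sym. Qed.
Lemma sum_irrefl : irreflexive sum_adj.
Proof. by case=> x /=; rewrite adj_irrefl. Qed.
Definition sum_graph : sgraph := SGraph sum_sym sum_irrefl.
End Sum.

Definition disjoint_union (s : seq sgraph) : sgraph :=
  foldr sum_graph empty_graph s.

(* [l] is the length, i.e. the number of edges; there are l + 1 vertices. *)
Section LinearGraph.
Variable l : nat.
Definition linear_adj : rel 'I_l.+1 :=
  fun i j => (i.+1 == j :> nat) || (j.+1 == i :> nat).
Lemma linear_sym : symmetric linear_adj.
Proof. by move=> i j; rewrite /linear_adj orbC. Qed.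
Lemma linear_irrefl : irreflexive linear_adj.
Proof. by move=> i; rewrite /linear_adj orbb gtn_eqF. Qed.
Definition linear_graph : sgraph := SGraph linear_sym linear_irrefl.
End LinearGraph.

(* This is the cycle C_n only for n >= 3; the conjunct i != j makes the
   definition a simple graph for every n. *)
Section CycleGraph.
Variable n : nat.
Definition cycle_adj : rel 'I_n :=
  fun i j => (i != j) && ((ordS i == j) || (ordS j == i)).
Lemma cycle_sym : symmetric cycle_adj.
Proof. by move=> i j; rewrite /cycle_adj eq_sym orbC. Qed.
Lemma cycle_irrefl : irreflexive cycle_adj.
Proof. by move=> i; rewrite /cycle_adj eqxx. Qed.
Definition cycle_graph : sgraph := SGraph cycle_sym cycle_irrefl.
End CycleGraph.

(* [ls] and [cs] list the lengths of the linear and of the cyclic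
   components, with multiplicity. *)
Definition linear_cycle_union (ls cs : seq nat) : sgraph :=
  disjoint_union (map linear_graph ls ++ map cycle_graph cs).

(* Main.v *)
Require Import Defs.
From mathcomp Require Import all_boot.
From mathcomp Require Import zify.
Set Implicit Arguments.
Unset Strict Implicit.
Unset Printing Implicit Defensive.

(** The simplices of the complement of [H] are the independent sets of [H], so
    the complement of a disjoint union is a join, and the complement of [k]
    disjoint edges is the join of [k] copies of the 0-sphere: the
    cross-polytope graph with [2 * k] vertices, which is a [(k - 1)]-sphere.
    The proof reduces [H] to a disjoint union of edges by moves that change the
    complement only up to homotopy, whatever other components are present
    ([ind_equiv]).  There are two moves.

    - Fold ([ind_equiv_extension]): a vertex [w] may be added or removed if some
      [u] not adjacent to [w] has all its neighbors among those of [w].  In the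
      complement, [u] is then adjacent to all the rest of the unit sphere of
      [w], which is a cone, hence contractible.
    - Edge ([ind_equiv_add_edge]): an edge [u v] may be added or deleted if some
      [t], distinct from and not adjacent to [u] and [v], has all its neighbors
      among those of [u] and [v].  In the complement the common neighborhood of
      [u] and [v] is then a cone with apex [t].

    In a path with vertices 0, 1, 2, 3, ..., vertex 2 folds away thanks to
    vertex 0, so that the edge 0-1 splits off and the length drops by 3
    ([linear_add3_equiv]).  In a cycle, let a, x, y, z, b be consecutive.  The
    chord a-b may be added because of y; then the edge x-a may be deleted
    because of z; finally z folds away because of x.  What remains is the edge
    x-y and a cycle shorter by 3 ([cycle_add3_equiv]).  Lengths not divisible
    by 3 bring this descent to the paths of length 1 and 2, or to the cycles of
    length 4 and to the degenerate 2-cycle, which is a single edge.  Each of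
    these is equivalent to one edge.  Hence a path of length [l] accounts for
    [l %/ 3 + 1] edges and a cycle of length [n] for [(n + 1) %/ 3], and the
    sphere has dimension one less than the total number of edges. *)

(** * Isomorphisms *)

Lemma iso_of_injection (G H : sgraph) (f : G -> H) :
  injective f -> #|H| <= #|G| ->
  (forall x y, adj (f x) (f y) = adj x y) -> isomorphic G H.
Proof.
by move=> f_inj leHG f_adj; exists f; split=> //; apply: inj_card_bij.
Qed.

Lemma iso_refl (G : sgraph) : isomorphic G G.
Proof. exact: (iso_of_injection (f := id)). Qed.

Lemma iso_sym (G H : sgraph) : isomorphic G H -> isomorphic H G.
Proof.
case=> f [[g fK gK] f_adj]; exists g; split; first by exists f.
by move=> x y; rewrite -f_adj !gK.
Qed.

Lemma iso_trans (G H K : sgraph) :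
  isomorphic G H -> isomorphic H K -> isomorphic G K.
Proof.
case=> f [f_bij f_adj] [g [g_bij g_adj]]; exists (g \o f).
by split=> [|x y /=]; [apply: bij_comp | rewrite g_adj f_adj].
Qed.

Lemma iso_complement (G H : sgraph) :
  isomorphic G H -> isomorphic (complement G) (complement H).
Proof.
case=> f [f_bij f_adj]; exists f; split=> // x y.
by rewrite /= /complement_adj f_adj (inj_eq (bij_inj f_bij)).
Qed.

(** * Contractible graphs and homotopies *)

Lemma card_unit_sphere (G : sgraph) (x : G) : #|unit_sphere x| < #|G|.
Proof.
rewrite card_sig; apply: proper_card; apply/properP; split; first exact/subsetP.
by exists x; rewrite // !inE adj_irrefl.
Qed.

Lemma card_remove_vertex (G : sgraph) (x : G) : #|remove_vertex x| < #|G|.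
Proof.
rewrite card_sig; apply: proper_card; apply/properP; split; first exact/subsetP.
by exists x; rewrite // !inE eqxx.
Qed.

(** Any vertex other than the apex can be removed: both its unit sphere and the
    rest of the graph are again cones with the same apex. *)
Lemma cone_contractible (G : sgraph) (u : G) :
  (forall x, x != u -> adj u x) -> contractible G.
Proof.
have [n] := ubnP #|G|; elim: n G u => // n IHn G u /ltnSE leGn apex.
have [/existsP[x xDu]|/existsPn all_u] := boolP [exists x : G, x != u];
    last first.
  apply: contractible_point; rewrite -(card1 u); apply: eq_card => x.
  by rewrite !inE (negPn (all_u x)).
have ux := apex x xDu.
apply: (@contractible_step G x).
- have uS : u \in [set y | adj x y] by rewrite inE adj_sym.
  apply: (IHn (unit_sphere x) (Sub u uS)).
    exact: leq_trans (card_unit_sphere x) leGn.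
  by move=> y yDu; apply: apex.
- have uR : u \in [set~ x] by rewrite !inE eq_sym.
  apply: (IHn (remove_vertex x) (Sub u uR)).
    exact: leq_trans (card_remove_vertex x) leGn.
  by move=> y yDu; apply: apex.
Qed.

(** [w] misses at most the vertex [v], and the neighbors of [v] form a cone with
    apex [t].  A vertex [c] that [t] does not see is not adjacent to [v] either,
    so that its unit sphere is a cone with apex [w]; removing all such [c] makes
    the graph a cone with apex [t]. *)
Lemma almost_cone_contractible (G : sgraph) (w v t : G) :
  (forall x, x != w -> x != v -> adj w x) -> t != w -> adj v t ->
  (forall x, adj v x -> x != t -> adj t x) -> contractible G.
Proof.
have [n] := ubnP #|G|; elim: n G w v t => // n IHn G w v t /ltnSE leGn.
move=> near_apex tDw vt tcone.
have tDv : t != v by apply: contraTneq vt => ->; rewrite adj_irrefl.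
have [|] := boolP [exists c : G, (c != t) && ~~ adj t c]; last first.
  move/existsPn=> apex; apply: (@cone_contractible G t) => x xDt.
  by have := apex x; rewrite xDt negbK.
case/existsP=> c /andP[cDt tNc].
have cDw : c != w by apply: contraNneq tNc => ->; rewrite adj_sym near_apex.
have cDv : c != v by apply: contraNneq tNc => ->; rewrite adj_sym.
have vNc : ~~ adj v c by apply: contra tNc => /tcone->.
apply: (@contractible_step G c).
- have wS : w \in [set y | adj c y] by rewrite inE adj_sym near_apex.
  apply: (@cone_contractible (unit_sphere c) (Sub w wS)) => -[y yS] yDw.
  have yDv : y != v by apply: contraTneq (yS) => ->; rewrite inE adj_sym.
  exact: near_apex.
- have inR (y : G) : c != y -> y \in [set~ c] by rewrite !inE eq_sym.
  apply: (IHn (remove_vertex c) (Sub w (inR w cDw)) (Sub v (inR v cDv))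
              (Sub t (inR t cDt))) => //.
    exact: leq_trans (card_remove_vertex c) leGn.
  + by move=> y yDw yDv; apply: near_apex.
  + by move=> y vy yDt; apply: tcone.
Qed.

(** An edge [u v] can be deleted if the common neighborhood of its ends is a
    cone, with apex [t].  Extend [G] by a vertex [w] that sees [u] and all
    neighbors of [u] but [v]: after the deletion of [u v], the vertex [w] could
    stand for [u].  Exchanging the names of [u] and [w] turns this extension of
    [G] into an extension of [G'], by a vertex that sees [u] and all its
    neighbors in [G].  The former extends along a cone with apex [u], the latter
    along the almost-cone of [almost_cone_contractible]. *)
Lemma homotopic_delete_edge (G G' : sgraph) (f : G' -> G) (u v t : G') :
  bijective f ->
  (forall x y, adj x y =
     adj (f x) (f y) && ~~ [&& x \in pred2 u v & y \in pred2 u v]) ->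
  adj (f u) (f v) -> adj (f u) (f t) -> adj (f v) (f t) ->
  (forall x, adj (f u) (f x) -> adj (f v) (f x) -> x != t -> adj (f t) (f x)) ->
  homotopic G G'.
Proof.
move=> f_bij adjE uv ut vt tcone.
have f_inj := bij_inj f_bij.
have uDv : u != v by apply: contraTneq uv => ->; rewrite adj_irrefl.
have tDu : t != u by apply: contraTneq ut => ->; rewrite adj_irrefl.
have tDv : t != v by apply: contraTneq vt => ->; rewrite adj_irrefl.
pose A := [set x | (x == f u) || (adj (f u) x && (x != f v))].
pose A' := [set x : G' | (x == u) || adj (f u) (f x)].
have contrA : contractible (induced A).
  have uA : f u \in A by rewrite inE eqxx.
  apply: (@cone_contractible (induced A) (Sub (f u) uA)) => -[x xA].
  rewrite -val_eqE /= => xDu; have := xA; rewrite inE (negPf xDu) /=.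
  by case/andP.
have contrA' : contractible (induced A').
  have uA' : u \in A' by rewrite inE eqxx.
  have vA' : v \in A' by rewrite inE uv orbT.
  have tA' : t \in A' by rewrite inE ut orbT.
  apply: (@almost_cone_contractible (induced A') (Sub u uA') (Sub v vA')
            (Sub t tA')) => //=.
  + move=> [x xA]; rewrite -!val_eqE /= => xDu xDv.
    move: xA; rewrite /induced_adj /= inE (negPf xDu) /= adjE => ->.
    by rewrite !inE (negPf xDu) (negPf xDv) andbF.
  + by rewrite /induced_adj /= adjE vt !inE (negPf tDu) (negPf tDv) andbF.
  + move=> [x xA]; rewrite -!val_eqE /induced_adj /= adjE => /andP[vx].
    rewrite !inE eqxx orbT /= => /norP[xDu _] xDt.
    move: xA; rewrite inE (negPf xDu) /= => ux.
    by rewrite adjE tcone // !inE (negPf tDu) (negPf tDv).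
apply: (homotopic_trans (homotopic_extension contrA)).
apply: homotopic_sym.
apply: (homotopic_trans (homotopic_extension contrA')).
apply: homotopic_iso.
(* The exchange of the new vertex with [u]. *)
pose g (x : option G') : option G :=
  if x is Some y then (if y == u then None else Some (f y)) else Some (f u).
apply: (@iso_of_injection (extension A') (extension A) g).
- move=> [x|] [y|] //=.
  + by have [->|_] := eqVneq x u; have [->|_] := eqVneq y u => // -[/f_inj->].
  + by have [//|xDu] := eqVneq x u => -[/f_inj xu]; rewrite xu eqxx in xDu.
  + by have [//|yDu] := eqVneq y u => -[/f_inj yu]; rewrite -yu eqxx in yDu.
- by rewrite !card_option (bij_eq_card f_bij).
- move=> [x|] [y|] //=; rewrite ?adj_irrefl //.
  + have [->|xDu] := eqVneq x u; have [->|yDu] := eqVneq y u => /=.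
    * by rewrite !adj_irrefl.
    * rewrite inE (inj_eq f_inj) (negPf yDu) /= adjE !inE eqxx (negPf yDu) /=.
      by rewrite (inj_eq f_inj).
    * rewrite inE (inj_eq f_inj) (negPf xDu) /= adjE !inE eqxx (negPf xDu) /=.
      by rewrite (inj_eq f_inj) andbT adj_sym.
    * rewrite adjE !inE (negPf xDu) (negPf yDu) /=.
      have [->|] := eqVneq x v; have [->|] := eqVneq y v; rewrite ?andbT //.
      by rewrite adj_irrefl.
  + have [->|xDu] := eqVneq x u; first by rewrite /= !inE !eqxx.
    by rewrite /= inE (negPf xDu) adj_sym.
  + have [->|yDu] := eqVneq y u; first by rewrite /= !inE !eqxx.
    by rewrite /= inE (negPf yDu).
Qed.

(** * Moves preserving the homotopy type of the complement *)

(** The complement acquires a vertex joined to the complement of [A], which is a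
    cone with apex [u]. *)
Lemma homotopic_complement_extension (K : sgraph) (A : {set K}) (u : K) :
  u \notin A -> (forall x, adj u x -> x \in A) ->
  homotopic (complement K) (complement (extension A)).
Proof.
move=> uNA NuA; have uAc : u \in ~: A by rewrite inE.
have contrAc : contractible (@induced (complement K) (~: A)).
  apply: (@cone_contractible (@induced (complement K) (~: A)) (Sub u uAc)).
  move=> [x xAc]; rewrite -val_eqE /induced_adj /= /complement_adj => xDu.
  rewrite eq_sym xDu; apply: contraTN xAc => /NuA xA.
  by rewrite inE negbK.
apply: (homotopic_trans (homotopic_extension contrAc)); apply: homotopic_iso.
apply: (@iso_of_injection (@extension (complement K) (~: A))
          (complement (extension A)) id) => // -[x|] [y|] //=.
- by rewrite /complement_adj inE.
- by rewrite /complement_adj inE.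
Qed.

Section AddEdge.
Variables (G : sgraph) (u v : G).
(** The conjunct [x != y] excludes loops at [u] and [v]. *)
Definition add_edge_adj : rel G := fun x y =>
  adj x y || [&& x != y, x \in pred2 u v & y \in pred2 u v].
Lemma add_edge_sym : symmetric add_edge_adj.
Proof.
move=> x y; rewrite /add_edge_adj adj_sym eq_sym.
by congr (_ || (_ && _)); rewrite andbC.
Qed.
Lemma add_edge_irrefl : irreflexive add_edge_adj.
Proof. by move=> x; rewrite /add_edge_adj adj_irrefl eqxx. Qed.
Definition add_edge : sgraph := SGraph add_edge_sym add_edge_irrefl.
End AddEdge.

(** The hypotheses on [t] say that in the complement it is a common neighbor of
    [u] and [v] and sees all the others. *)
Lemma homotopic_complement_add_edge (K : sgraph) (u v t : K) :
  u != v -> t != u -> t != v -> ~~ adj u t -> ~~ adj v t ->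
  (forall x, adj t x -> adj u x || adj v x) ->
  homotopic (complement K) (complement (add_edge u v)).
Proof.
move=> uDv tDu tDv uNt vNt Nt.
have [uv|uNv] := boolP (adj u v).
  apply: homotopic_iso; apply: iso_complement.
  apply: (@iso_of_injection K (add_edge u v) id) => // x y.
  rewrite /= /add_edge_adj; case: (boolP (adj x y)) => //= xNy.
  apply: negbTE; apply/negP=> /and3P[xDy]; rewrite !inE.
  move=> /orP[]/eqP xE /orP[]/eqP yE;
    by move: xNy xDy; rewrite xE yE ?eqxx ?uv // adj_sym uv.
apply: (@homotopic_delete_edge (complement K) (complement (add_edge u v))
          id u v t) => //=.
- by exists id.
- move=> x y; rewrite /complement_adj /add_edge_adj negb_or -andbA.
  by case: (x != y).
- by rewrite /complement_adj uDv.
- by rewrite /complement_adj eq_sym tDu.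
- by rewrite /complement_adj eq_sym tDv.
- move=> x; rewrite /complement_adj => /andP[_ uNx] /andP[_ vNx] xDt.
  by rewrite eq_sym xDt; apply: contra uNx => /Nt/orP[//|vx]; rewrite vx in vNx.
Qed.

(** * Disjoint unions *)

Lemma sum_isoC (G H : sgraph) : isomorphic (sum_graph G H) (sum_graph H G).
Proof.
pose f (x : sum_graph G H) : sum_graph H G :=
  match x with inl y => inr y | inr y => inl y end.
apply: (@iso_of_injection _ _ f).
- by case=> x [] y // [->].
- by rewrite !card_sum addnC.
- by case=> x [].
Qed.

Lemma sum_isoA (G H K : sgraph) :
  isomorphic (sum_graph G (sum_graph H K)) (sum_graph (sum_graph G H) K).
Proof.
pose f (x : sum_graph G (sum_graph H K)) : sum_graph (sum_graph G H) K :=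
  match x with
  | inl y => inl (inl y)
  | inr (inl y) => inl (inr y)
  | inr (inr y) => inr y
  end.
apply: (@iso_of_injection _ _ f).
- by case=> [x|[x|x]] [y|[y|y]] // [->].
- by rewrite !card_sum addnA.
- by case=> [x|[x|x]] [y|[y|y]].
Qed.

Lemma sum_iso (G G' H H' : sgraph) : isomorphic G G' -> isomorphic H H' ->
  isomorphic (sum_graph G H) (sum_graph G' H').
Proof.
case=> f [f_bij f_adj] [g [g_bij g_adj]].
pose h (x : sum_graph G H) : sum_graph G' H' :=
  match x with inl y => inl (f y) | inr y => inr (g y) end.
apply: (@iso_of_injection _ _ h).
- by case=> x [] y // [] => [/(bij_inj f_bij)|/(bij_inj g_bij)]->.
- by rewrite !card_sum (bij_eq_card f_bij) (bij_eq_card g_bij).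
- by case=> x [] y //=.
Qed.

Lemma sum_empty_iso (G : sgraph) : isomorphic (sum_graph empty_graph G) G.
Proof.
apply: iso_sym.
apply: (@iso_of_injection G (sum_graph empty_graph G) inr) => //.
- by move=> x y [].
- by rewrite card_sum card_void.
Qed.

(** Simplices of the complement of [H] are independent sets of [H], whence the
    name.  The quantification over a further component [M] makes the relation a
    congruence for disjoint unions without any need to show that joins preserve
    homotopies. *)
Definition ind_equiv (H H' : sgraph) : Prop := forall M : sgraph,
  homotopic (complement (sum_graph M H)) (complement (sum_graph M H')).

Lemma ind_equiv_iso (H H' : sgraph) : isomorphic H H' -> ind_equiv H H'.
Proof.
move=> isoHH' M; apply: homotopic_iso; apply: iso_complement.
by apply: sum_iso => //; apply: iso_refl.
Qed.

Lemma ind_equiv_sym (H H' : sgraph) : ind_equiv H H' -> ind_equiv H' H.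
Proof. by move=> eqHH' M; apply: homotopic_sym. Qed.

Lemma ind_equiv_trans (H H' H'' : sgraph) :
  ind_equiv H H' -> ind_equiv H' H'' -> ind_equiv H H''.
Proof. by move=> eqHH' eqH'' M; apply: homotopic_trans (eqHH' M) (eqH'' M). Qed.

Lemma ind_equiv_sumr (G H H' : sgraph) :
  ind_equiv H H' -> ind_equiv (sum_graph G H) (sum_graph G H').
Proof.
move=> eqHH' M.
apply: homotopic_trans (homotopic_trans (eqHH' (sum_graph M G)) _).
  by apply: homotopic_iso; apply: iso_complement; apply: sum_isoA.
apply: homotopic_iso; apply: iso_complement; apply: iso_sym; exact: sum_isoA.
Qed.

Lemma ind_equiv_sum (G G' H H' : sgraph) : ind_equiv G G' -> ind_equiv H H' ->
  ind_equiv (sum_graph G H) (sum_graph G' H').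
Proof.
move=> eqGG' eqHH'; apply: (ind_equiv_trans (ind_equiv_sumr G eqHH')).
apply: (ind_equiv_trans (ind_equiv_iso (sum_isoC G H'))).
apply: (ind_equiv_trans (ind_equiv_sumr H' eqGG')).
exact: ind_equiv_iso (sum_isoC H' G').
Qed.

Lemma ind_equiv_homotopic (H H' : sgraph) :
  ind_equiv H H' -> homotopic (complement H) (complement H').
Proof.
move=> /(_ empty_graph) eqHH'.
apply: homotopic_trans (homotopic_trans eqHH' _).
  apply: homotopic_iso; apply: iso_complement; apply: iso_sym.
  exact: sum_empty_iso.
by apply: homotopic_iso; apply: iso_complement; apply: sum_empty_iso.
Qed.

(** The hypotheses concern neighborhoods only, so they persist when a component
    [M] is added, and [homotopic_complement_extension] applies to the sum. *)
Lemma ind_equiv_extension (K : sgraph) (A : {set K}) (u : K) :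
  u \notin A -> (forall x, adj u x -> x \in A) -> ind_equiv (extension A) K.
Proof.
move=> uNA NuA M; apply: homotopic_sym.
pose B : {set sum_graph M K} := [set inr x | x in A].
have inB x : (inr x \in B) = (x \in A).
  by rewrite mem_imset // => y z [].
have inlB x : (inl x \in B) = false by apply/imsetP=> -[].
apply: (homotopic_trans (@homotopic_complement_extension _ B (inr u) _ _)).
- by rewrite inB.
- by move=> [x|x] //= /NuA; rewrite inB.
apply: homotopic_iso; apply: iso_complement.
pose f (x : extension B) : sum_graph M (extension A) :=
  match x with
  | Some (inl y) => inl y
  | Some (inr y) => inr (Some y)
  | None => inr None
  end.
apply: (@iso_of_injection _ _ f).
- by move=> [[x|x]|] [[y|y]|] // [->].
- by rewrite card_option !card_sum card_option addnS.
- by move=> [[x|x]|] [[y|y]|] //=; rewrite ?inB ?inlB.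
Qed.

Lemma ind_equiv_add_edge (K : sgraph) (u v t : K) :
  u != v -> t != u -> t != v -> ~~ adj u t -> ~~ adj v t ->
  (forall x, adj t x -> adj u x || adj v x) -> ind_equiv (add_edge u v) K.
Proof.
move=> uDv tDu tDv uNt vNt Nt M; apply: homotopic_sym.
have := @homotopic_complement_add_edge (sum_graph M K) (inr u) (inr v) (inr t).
move=> /(_ uDv tDu tDv uNt vNt) hom.
apply: homotopic_trans (hom _) _; first by case=> x //= /Nt.
apply: homotopic_iso; apply: iso_complement.
apply: (@iso_of_injection (@add_edge (sum_graph M K) (inr u) (inr v))
          (sum_graph M (add_edge u v)) id) => // -[x|x] [y|y] //=;
  rewrite /add_edge_adj //= ?andbF //.
by rewrite orbF.
Qed.

(** * Shortening paths and cycles *)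

Lemma cycle_adjE n (i j : 'I_n) : cycle_adj i j =
  (i != j) && [|| i.+1 == j, j.+1 == i, (i == 0 :> nat) && (j.+1 == n)
                | (j == 0 :> nat) && (i.+1 == n)].
Proof.
have succE (a b : 'I_n) :
    (ordS a == b) = (a.+1 == b :> nat) || (b == 0 :> nat) && (a.+1 == n).
  rewrite -val_eqE /=; have := ltn_ord a.
  rewrite leq_eqVlt => /predU1P[aE|ltan].
    by rewrite aE modnn eqxx andbT eq_sym (gtn_eqF (ltn_ord b)).
  by rewrite modn_small // (ltn_eqF ltan) andbF orbF.
rewrite /cycle_adj !succE; congr (_ && _); lia.
Qed.

(** The path is an edge [0 - 1] and a path of length [l], linked by an extra
    vertex [2] joined to [1] and to the start of the second path.  All neighbors
    of [0] are neighbors of [2], so the link can be removed. *)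
Lemma linear_add3_equiv l :
  ind_equiv (linear_graph l.+3) (sum_graph (linear_graph 1) (linear_graph l)).
Proof.
pose R := sum_graph (linear_graph 1) (linear_graph l).
pose A := [set x : R | match x with
                       | inl i => i == 1 :> nat
                       | inr i => i == 0 :> nat
                       end].
apply: (@ind_equiv_trans _ (extension A)); last first.
  apply: (@ind_equiv_extension R A (inl ord0)); first by rewrite inE.
  by case=> [i|i] //; rewrite inE /= /linear_adj /= orbF eq_sym.
apply: ind_equiv_iso; apply: iso_sym.
pose f (x : extension A) : linear_graph l.+3 :=
  match x with
  | None => inord 2
  | Some (inl i) => inord i
  | Some (inr i) => inord (i + 3)
  end.
have fE (x : extension A) : nat_of_ord (f x) = match x with
  | None => 2 | Some (inl i) => i | Some (inr i) => i + 3 end.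
  by case: x => [[[i lti]|[i lti]]|] /=; rewrite inordK //; lia.
apply: (@iso_of_injection _ _ f).
- move=> x y /(congr1 val) /=; rewrite !fE.
  case: x y => [[[i lti]|[i lti]]|] [[[j ltj]|[j ltj]]|] //= eq_ij;
    first [exfalso; lia | congr (Some (inl _)) | congr (Some (inr _))];
    by apply: val_inj => /=; lia.
- by rewrite card_option card_sum !card_ord; lia.
- move=> x y; rewrite /= /linear_adj !fE.
  by case: x y => [[[i lti]|[i lti]]|] [[[j ltj]|[j ltj]]|];
    rewrite //= ?inE /= /linear_adj /=; lia.
Qed.

(** Vertex [2] folds away thanks to vertex [0]. *)
Lemma linear2_equiv : ind_equiv (linear_graph 2) (linear_graph 1).
Proof.
pose A := [set x : linear_graph 1 | x == 1 :> nat].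
apply: (@ind_equiv_trans _ (extension A)); last first.
  apply: (@ind_equiv_extension _ A ord0); first by rewrite inE.
  by move=> i; rewrite inE /= /linear_adj /= orbF eq_sym.
apply: ind_equiv_iso; apply: iso_sym.
pose f (x : extension A) : linear_graph 2 :=
  if x is Some i then inord i else inord 2.
have fE (x : extension A) : nat_of_ord (f x) = if x is Some i then i else 2.
  by case: x => [[i lti]|] /=; rewrite inordK //; lia.
apply: (@iso_of_injection _ _ f).
- move=> x y /(congr1 val) /=; rewrite !fE.
  case: x y => [[i lti]|] [[j ltj]|] //= eq_ij;
    by [exfalso; lia | congr Some; apply: val_inj].
- by rewrite card_option !card_ord.
- move=> x y; rewrite /= /linear_adj !fE.
  by case: x y => [[i lti]|] [[j ltj]|];
    rewrite //= ?inE /= /linear_adj /=; lia.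
Qed.

(** Opposite vertices of a square have the same neighbors, so one of them can be
    removed; this leaves a path of length 2. *)
Lemma cycle4_equiv : ind_equiv (cycle_graph 4) (linear_graph 2).
Proof.
pose A := [set x : linear_graph 2 | x != 1 :> nat].
apply: (@ind_equiv_trans _ (extension A)); last first.
  apply: (@ind_equiv_extension _ A (inord 1)); first by rewrite inE inordK.
  by move=> i; rewrite inE /= /linear_adj inordK //; lia.
apply: ind_equiv_iso; apply: iso_sym.
pose f (x : extension A) : cycle_graph 4 :=
  if x is Some i then inord i else inord 3.
have fE (x : extension A) : nat_of_ord (f x) = if x is Some i then i else 3.
  by case: x => [[i lti]|] /=; rewrite inordK //; lia.
apply: (@iso_of_injection _ _ f).
- move=> x y /(congr1 val) /=; rewrite !fE.
  case: x y => [[i lti]|] [[j ltj]|] //= eq_ij;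
    by [exfalso; lia | congr Some; apply: val_inj].
- by rewrite card_option !card_ord.
- move=> x y; rewrite /= cycle_adjE -val_eqE /= !fE.
  by case: x y => [[i lti]|] [[j ltj]|];
    rewrite //= ?inE /= /linear_adj /=; lia.
Qed.

(** Let a, x, y, z, b be consecutive in the longer cycle.  The cycle with the
    chord a-b is also what one gets from the edge x-y and the cycle that closes
    at a-b by adding z, joined to y and b, and then the edge x-a.  Each of the
    added pieces is removable, which compares the two sides.  The bound on [n]
    makes a and b distinct; for [n = 2] they are already adjacent. *)
Lemma cycle_add3_equiv n : 2 <= n ->
  ind_equiv (cycle_graph n.+3) (sum_graph (linear_graph 1) (cycle_graph n)).
Proof.
case: n => [|[|n]] // _.
pose C := cycle_graph n.+2; pose C3 := cycle_graph n.+2.+3.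
pose R := sum_graph (linear_graph 1) C.
pose A := [set x : R | match x with
                       | inl i => i == 1 :> nat
                       | inr i => i == 0 :> nat
                       end].
(* With N = n + 2 the length of the shorter cycle, whose vertices 0, ..., n + 1
   keep their names: a = n + 1, x = n + 2, y = n + 3, z = n + 4, b = 0.
   On the other side [None] is z, [p0] is x and [p1] is a. *)
pose a : C3 := inord n.+1; pose b : C3 := ord0; pose y : C3 := inord n.+3.
have aE : nat_of_ord a = n.+1 by rewrite inordK //; lia.
have yE : nat_of_ord y = n.+3 by rewrite inordK //; lia.
pose p0 : extension A := Some (inl ord0).
pose p1 : extension A := Some (inr ord_max).
apply: (@ind_equiv_trans _ (add_edge a b)).
  apply: ind_equiv_sym; apply: (@ind_equiv_add_edge C3 a b y).
  - by rewrite -val_eqE /= aE.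
  - by rewrite -val_eqE /= aE yE; lia.
  - by rewrite -val_eqE /= yE.
  - by rewrite /= cycle_adjE -val_eqE /= aE yE; lia.
  - by rewrite /= cycle_adjE -val_eqE /= yE; lia.
  - by move=> [z ltz]; rewrite /= !cycle_adjE -!val_eqE /= aE yE; lia.
apply: (@ind_equiv_trans _ (add_edge p0 p1)); last first.
  apply: (@ind_equiv_trans _ (extension A)); last first.
    apply: (@ind_equiv_extension R A (inl ord0)); first by rewrite inE.
    by case=> [i|i] //; rewrite inE /= /linear_adj /= orbF eq_sym.
  apply: (@ind_equiv_add_edge _ p0 p1 None) => //=; rewrite ?inE //=.
  case=> [[i|i]|] //=; rewrite inE /= => /eqP iE.
  - by rewrite /linear_adj iE.
  - by rewrite cycle_adjE -val_eqE /= iE; lia.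
apply: ind_equiv_iso; apply: iso_sym.
pose f (x : add_edge p0 p1) : add_edge a b :=
  match x with
  | None => inord n.+4
  | Some (inl i) => inord (i + n.+2)
  | Some (inr i) => inord i
  end.
have fE (x : add_edge p0 p1) : nat_of_ord (f x) = match x with
  | None => n.+4 | Some (inl i) => i + n.+2 | Some (inr i) => i end.
  by case: x => [[[i lti]|[i lti]]|] /=; rewrite inordK //; lia.
have f_inj : injective f.
  move=> u v /(congr1 val) /=; rewrite !fE.
  case: u v => [[[i lti]|[i lti]]|] [[[j ltj]|[j ltj]]|] //= eq_ij;
    first [exfalso; lia | congr (Some (inl _)) | congr (Some (inr _))];
    by apply: val_inj => /=; lia.
have p0E x : (x == p0) = if x is Some (inl i) then i == 0 :> nat else false.
  by case: x => [[i|i]|].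
have p1E x : (x == p1) = if x is Some (inr i) then i == n.+1 :> nat else false.
  by case: x => [[i|i]|].
apply: (iso_of_injection f_inj).
- by rewrite card_option card_sum !card_ord; lia.
- move=> u v; rewrite /= /add_edge_adj -(inj_eq f_inj u v) /= cycle_adjE !inE.
  rewrite -!val_eqE /= aE !p0E !p1E !fE.
  by case: u v => [[[i lti]|[i lti]]|] [[[j ltj]|[j ltj]]|];
    rewrite //= ?inE /= /linear_adj ?cycle_adjE -?val_eqE /=; lia.
Qed.

(** * Reduction to disjoint edges *)

Definition matching (k : nat) : sgraph :=
  disjoint_union (nseq k (linear_graph 1)).

Lemma disjoint_union_cat_iso (s s' : seq sgraph) :
  isomorphic (disjoint_union (s ++ s'))
             (sum_graph (disjoint_union s) (disjoint_union s')).
Proof.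
elim: s => [|G s IHs] /=; first exact: iso_sym (sum_empty_iso _).
exact: iso_trans (sum_iso (iso_refl G) IHs) (sum_isoA _ _ _).
Qed.

Lemma matching_add_equiv k k' :
  ind_equiv (sum_graph (matching k) (matching k')) (matching (k + k')).
Proof.
apply: ind_equiv_iso; rewrite /matching nseqD.
exact: iso_sym (disjoint_union_cat_iso _ _).
Qed.

Lemma matching1_equiv : ind_equiv (linear_graph 1) (matching 1).
Proof.
apply: ind_equiv_iso; apply: iso_sym.
exact: iso_trans (sum_isoC _ _) (sum_empty_iso _).
Qed.

Lemma linear_matching_equiv l :
  ~~ (3 %| l) -> ind_equiv (linear_graph l) (matching (l %/ 3).+1).
Proof.
elim/ltn_ind: l => -[|[|[|l]]] IHl // l3.
- exact: matching1_equiv.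
- exact: ind_equiv_trans linear2_equiv matching1_equiv.
- have {IHl} IHl : ind_equiv (linear_graph l) (matching (l %/ 3).+1).
    by apply: IHl; lia.
  apply: (ind_equiv_trans (linear_add3_equiv l)).
  apply: (ind_equiv_trans (ind_equiv_sum matching1_equiv IHl)).
  have -> : l.+3 %/ 3 = (l %/ 3).+1 by lia.
  exact: matching_add_equiv.
Qed.

(** The 2-cycle, a single edge, is included so that the descent by 3 from
    length 5 has somewhere to stop. *)
Lemma cycle_matching_equiv n :
  2 <= n -> ~~ (3 %| n) -> ind_equiv (cycle_graph n) (matching (n.+1 %/ 3)).
Proof.
elim/ltn_ind: n => -[|[|[|[|[|n]]]]] IHn // _ n3.
- apply: ind_equiv_trans matching1_equiv; apply: ind_equiv_iso.
  apply: (@iso_of_injection (cycle_graph 2) (linear_graph 1) id) => // i j.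
  by rewrite /= /linear_adj cycle_adjE; case: i j => [[|[]]] // ? [[|[]]].
- exact: ind_equiv_trans cycle4_equiv (linear_matching_equiv _).
- have {IHn} IHn : ind_equiv (cycle_graph n.+2) (matching (n.+3 %/ 3)).
    by apply: IHn; lia.
  apply: (ind_equiv_trans (@cycle_add3_equiv n.+2 _)) => //.
  apply: (ind_equiv_trans (ind_equiv_sum matching1_equiv IHn)).
  have -> : n.+2.+4 %/ 3 = 1 + n.+3 %/ 3 by lia.
  exact: matching_add_equiv.
Qed.

Lemma disjoint_union_matching_equiv (T : eqType) (comp : T -> sgraph)
    (k : T -> nat) (s : seq T) :
  {in s, forall i, ind_equiv (comp i) (matching (k i))} ->
  ind_equiv (disjoint_union (map comp s)) (matching (sumn (map k s))).
Proof.
elim: s => [|i s IHs] eq_s; first exact: ind_equiv_iso (iso_refl _).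
apply: (ind_equiv_trans _ (matching_add_equiv _ _)); apply: ind_equiv_sum.
- by apply: eq_s; rewrite mem_head.
- by apply: IHs => j sj; apply: eq_s; rewrite inE sj orbT.
Qed.

(** * Cross-polytopes are spheres *)

(** These are the complements of perfect matchings; [y] is the antipode of [x],
    its match. *)
Definition cross_polytope (G : sgraph) : Prop := forall x : G,
  exists2 y : G, y != x & forall z, adj x z = (z != x) && (z != y).

(** Being antipodal is symmetric: [x] is a vertex that [y] does not see, and
    there is only one. *)
Lemma cross_polytope_antipode (G : sgraph) (x y z : G) :
  cross_polytope G -> y != x -> ~~ adj x y -> adj y z = (z != y) && (z != x).
Proof.
move=> /(_ y)[x' x'Dy adj_y] yDx; rewrite adj_sym !adj_y negb_and !negbK.
by rewrite eq_sym (negPf yDx) => /= /eqP->.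
Qed.

(** If [y] sees [x], so does the antipode of [y]: otherwise it would also be the
    antipode of [x]. *)
Lemma cross_polytope_unit_sphere (G : sgraph) (x : G) :
  cross_polytope G -> cross_polytope (unit_sphere x).
Proof.
move=> crossG [y yS]; have xy : adj x y by rewrite inE in yS.
have [z zDy adj_y] := crossG y.
have zNy : ~~ adj z y by rewrite adj_sym adj_y eqxx andbF.
have zDx : z != x by apply: contraNneq zNy => ->.
have zS : z \in [set t | adj x t].
  rewrite inE; apply: contraNT zNy => xNz.
  rewrite (cross_polytope_antipode _ crossG zDx xNz) eq_sym zDy.
  by apply: contraTneq xy => ->; rewrite adj_irrefl.
by exists (Sub z zS) => [|[t tS]]; rewrite -?val_eqE //; apply: adj_y.
Qed.

(** The unit sphere of [x] is obtained by deleting [x] and its antipode [y].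
    Once [x] alone is removed, [y] sees all other vertices. *)
Lemma cross_polytope_presphere k (G : sgraph) :
  cross_polytope G -> #|G| = k.*2 -> presphere k G.
Proof.
elim: k G => [|k IHk] G crossG cardG //=; split=> [x|].
  apply: IHk; first exact: cross_polytope_unit_sphere.
  have [y yDx adj_x] := crossG x.
  have -> : #|unit_sphere x| = #|~: [set x; y]|.
    by rewrite card_sig; apply: eq_card => z; rewrite !inE adj_x negb_or.
  by have := cardsC [set x; y]; rewrite cards2 eq_sym yDx cardG; lia.
have /card_gt0P[x _] : 0 < #|G| by rewrite cardG.
have [y yDx adj_x] := crossG x; exists x.
have yR : y \in [set~ x] by rewrite !inE.
have xNy : ~~ adj x y by rewrite adj_x eqxx andbF.
apply: (@cone_contractible (remove_vertex x) (Sub y yR)) => -[t tR].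
rewrite -val_eqE /= => tDy.
rewrite /induced_adj /= (cross_polytope_antipode _ crossG yDx xNy) tDy.
by move: tR; rewrite !inE.
Qed.

Lemma cross_polytope_complement_matching k :
  cross_polytope (complement (matching k)).
Proof.
elim: k => [|k IHk]; first by case.
case=> x.
- exists (inl (rev_ord x)); first by case: x => [[|[]]].
  by move=> [y|y]; case: x => [[|[]]] // ?; case: y => [[|[]]].
- have [y yDx adj_x] := IHk x; exists (inr y) => // -[z|z] //.
  exact: (adj_x z).
Qed.

Lemma card_matching k : #|matching k| = k.*2.
Proof.
elim: k => [|k IHk]; first exact: card_void.
by rewrite card_sum card_ord [#|_|]IHk.
Qed.

(** * The theorem *)

Theorem corollary2 :
  exists dim : seq nat -> seq nat -> nat,
    (forall ls ls' cs cs' : seq nat,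
       perm_eq ls ls' -> perm_eq cs cs' -> dim ls cs = dim ls' cs') /\
    (forall (H : sgraph) (ls cs : seq nat),
       isomorphic H (linear_cycle_union ls cs) ->
       ls ++ cs <> [::] ->
       (forall c : nat, c \in cs -> 3 <= c) ->
       (forall l : nat, l \in ls ++ cs -> ~~ (3 %| l)) ->
       exists S : sgraph,
         is_sphere (dim ls cs) S /\ homotopic (complement H) S).
Proof.
pose kl l := (l %/ 3).+1; pose kc n := n.+1 %/ 3.
pose k ls cs := sumn (map kl ls) + sumn (map kc cs).
exists (fun ls cs => (k ls cs).-1); split=> [ls ls' cs cs' eq_ls eq_cs|].
  by rewrite /k (perm_sumn (perm_map kl eq_ls)) (perm_sumn (perm_map kc eq_cs)).
move=> H ls cs isoH nonempty cs_ge3 not3.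
exists (complement (matching (k ls cs))); split.
  have k_gt0 : 0 < k ls cs.
    case: ls cs nonempty cs_ge3 {isoH not3} => [|l ls] [|c cs] // _ cs_ge3.
    have := cs_ge3 c (mem_head _ _); rewrite /k /kc /=; lia.
  rewrite /is_sphere prednK //; apply: cross_polytope_presphere.
    exact: cross_polytope_complement_matching.
  exact: card_matching.
apply: (homotopic_trans (homotopic_iso (iso_complement isoH))).
apply: ind_equiv_homotopic.
apply: (ind_equiv_trans (ind_equiv_iso (disjoint_union_cat_iso _ _))).
apply: ind_equiv_trans (matching_add_equiv _ _).
apply: ind_equiv_sum; apply: disjoint_union_matching_equiv => i i_in.
  by apply: linear_matching_equiv; apply: not3; rewrite mem_cat i_in.
apply: cycle_matching_equiv; first exact: ltnW (cs_ge3 i i_in).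
by apply: not3; rewrite mem_cat i_in orbT.
Qed.
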